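(* Let $d\ge1$, $0<\xi\le1$ and $w_1,\dots,w_d>0$. Let $\mathcal J$ be a collection of non-empty subsets of $\{1,\dots,d\}$ and $\boldsymbol c=(c_J)_{J\in\mathcal J}\in\mathbb R_+^{|\mathcal J|}$ such that: (1) $\{1\},\dots,\{d\}\in\mathcal J$ and $c_{\{j\}}=1$ for $j=1,\dots,d$; (2) $\sum_{j=1}^d u_j<\sum_{J\in\mathcal J}\max_{j\in J}u_j$ for all $\boldsymbol u\in\mathbb S_+$; (3) there exists at least one finite Borel measure $H$ on $\mathbb S_+$ with $\int_{\mathbb S_+}\max_{j\in J}u_j\,H(d\boldsymbol u)=c_J$ for all $J\in\mathcal J$. Let $\mathrm{val}(\mathcal L_\rho)$ and $\mathrm{val}(\mathcal U_\rho)$ be, respectively, the infimum and the supremum of $$\int_{\mathbb S_+}\big(w_1u_1^\xi+\cdots+w_du_d^\xi\big)^{1/\xi}H(d\boldsymbol u)$$ over all finite Borel measures $H$ on $\mathbb S_+$ satisfying $\int_{\mathbb S_+}\max_{j\in J}u_j\,H(d\boldsymbol u)=c_J$ for all $J\in\mathcal J$. Define the set of non-negative $d\times|\mathcal J|$ matrices (columns indexed by $\mathcal J$) $$\mathcal A_{\boldsymbol c}:=\Big\{A=(a_{jK})\in\mathbb R_+^{d\times|\mathcal J|}:\ \sum_{K\in\mathcal J}\max_{j\in J}a_{jK}=c_J,\ J\in\mathcal J\Big\}$$ and let $f(A):=\sum_{K\in\mathcal J}\big(w_1a_{1K}^\xi+\cdots+w_da_{dK}^\xi\big)^{1/\xi}$.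 Then $$\mathrm{val}(\mathcal L_\rho)=\inf_{A\in\mathcal A_{\boldsymbol c}}f(A)\quad\text{and}\quad\mathrm{val}(\mathcal U_\rho)=\sup_{A\in\mathcal A_{\boldsymbol c}}f(A).$$
   Context: $\mathbb S_+=\{\boldsymbol u\in[0,\infty)^d:\sum_{i=1}^du_i=1\}$ is the unit simplex; $\mathbb R_+=[0,\infty)$; all measures are non-negative. *)

(* Defs.v *)
From HB Require Import structures.
From mathcomp Require Import all_boot all_order all_algebra.
From mathcomp Require Import all_classical all_reals all_analysis.

Set Implicit Arguments.
Unset Strict Implicit.
Unset Printing Implicit Defensive.

Import Order.TTheory GRing.Theory Num.Theory.
Import numFieldNormedType.Exports.

Local Open Scope classical_set_scope.
Local Open Scope ring_scope.

(* Throughout, the ambient dimension is n.+1: this is how "d >= 1" is encoded,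
   and it makes the simplex non-empty, as the pointed structure required of a
   measurable type demands. *)

Definition simplex (R : realType) (n : nat) : set 'rV[R]_n.+1 :=
  [set u | (forall i, 0 <= u ord0 i) /\ \sum_i u ord0 i = 1].

Lemma simplex_vertex (R : realType) (n : nat) :
  (\row_i (i == ord0)%:R : 'rV[R]_n.+1) \in @simplex R n.
Proof.
rewrite inE; split=> [i|]; first by rewrite mxE ler0n.
rewrite (bigD1 ord0) //= mxE eqxx big1 ?addr0// => i /negbTE i0.
by rewrite mxE i0.
Qed.

(* The simplex as a type of its own, with the subspace topology of R^(n+1). *)
Definition simplexT (R : realType) (n : nat) : Type := set_type (@simplex R n).

HB.instance Definition _ (R : realType) (n : nat) :=
  Topological.copy (simplexT R n) (set_type (@simplex R n)).
HB.instance Definition _ (R : realType) (n : nat) :=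
  isPointed.Build (simplexT R n) (SigSub (simplex_vertex R n)).

(* [simplexT R n] with its Borel sigma-algebra. *)
Definition simplexB (R : realType) (n : nat) :=
  g_sigma_algebraType (@open (simplexT R n)).

Definition coords (R : realType) (n : nat) (u : simplexB R n) : 'I_n.+1 -> R :=
  fun i => (\val (u : simplexT R n) : 'rV[R]_n.+1) ord0 i.

(* The default value 0 is harmless: [maxover] is only applied to non-empty J
   and non-negative v. *)
Definition maxover (R : realType) (n : nat) (J : {set 'I_n.+1})
    (v : 'I_n.+1 -> R) : R :=
  \big[Num.max/0]_(j in J) v j.

Definition ell (R : realType) (n : nat) (xi : R) (w : 'I_n.+1 -> R)
    (v : 'I_n.+1 -> R) : R :=
  (\sum_j w j * v j `^ xi) `^ (1 / xi).

Section Problem.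
Context (R : realType) (n : nat).
Variables (calJ : {set {set 'I_n.+1}}) (c : {set 'I_n.+1} -> R).
Variables (xi : R) (w : 'I_n.+1 -> R).

(* Only the values of [c] on [calJ] matter. *)
Definition feasible : set {finite_measure set (simplexB R n) -> \bar R} :=
  [set H | forall J, J \in calJ ->
    (\int[H]_u (maxover J (coords u))%:E = (c J)%:E)%E].

Definition objective (H : {finite_measure set (simplexB R n) -> \bar R}) :
    \bar R :=
  (\int[H]_u (ell xi w (coords u))%:E)%E.

Definition lower_value : \bar R := ereal_inf [set objective H | H in feasible].

Definition upper_value : \bar R := ereal_sup [set objective H | H in feasible].

(* The columns are indexed by the enumeration of [calJ]; neither the constraints
   nor [coefmat_obj] below depend on which element of [calJ] labels a column. *)
Definition coefmat : set 'M[R]_(n.+1, #|calJ|) :=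
  [set A | (forall j K, 0 <= A j K) /\
    forall J, J \in calJ ->
      \sum_(K < #|calJ|) maxover J (fun j => A j K) = c J].

Definition coefmat_obj (A : 'M[R]_(n.+1, #|calJ|)) : R :=
  \sum_(K < #|calJ|) ell xi w (fun j => A j K).

End Problem.

Arguments coefmat {R n} calJ c.
Arguments coefmat_obj {R n calJ} xi w A.

(* Main.v *)
(* By homogeneity the columns of a matrix in A_c are the weighted atoms of a
   discrete feasible measure with the same objective, so only the following is
   needed: for every feasible H and every real sg there is A in A_c with
   sg f(A) <= sg * objective H (used with sg = 1 and sg = -1).  Partitioning the
   simplex into the level cells of the finitely many integrands replaces H, up to
   an error e, by a discrete measure.  The coordinates sum to 1, so every linear
   dependence between atoms has weights summing to 0; moving along it in the
   direction that does not increase the objective kills an atom, until at most |J|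
   atoms remain.  The resulting matrices stay in a compact box, and minimizing the
   violation of the constraints and of the objective bound over it lets e tend
   to 0. *)

Require Import Defs.
From HB Require Import structures.
From mathcomp Require Import all_boot all_order all_algebra.
From mathcomp Require Import all_classical all_reals all_analysis.
From mathcomp Require Import measurable_realfun lra.

Set Implicit Arguments.
Unset Strict Implicit.
Unset Printing Implicit Defensive.

Import Order.TTheory GRing.Theory Num.Theory.
Import numFieldNormedType.Exports.

Local Open Scope classical_set_scope.
Local Open Scope ring_scope.

(** * Reducing the number of atoms in a conic combination *)

(** With more rows than columns, the rows of [G] are dependent. Since [y] writes the constant 1 as a
    combination of the columns, the weights of a dependence sum to 0. A non-zero one thus has a
    negative entry, so that moving along it must reach the boundary of the orthant. *)
Lemma conic_drop_atom (R : realFieldType) (m N : nat) (G : 'M[R]_(N.+1, m))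
    (f : 'cV[R]_N.+1) (y : 'cV[R]_m) (s : 'rV[R]_N.+1) :
  (m <= N)%N -> G *m y = const_mx 1 -> (forall k, 0 <= s 0 k) ->
  exists k0 (s' : 'rV[R]_N),
    [/\ forall k, 0 <= s' 0 k, s' *m rowsub (lift k0) G = s *m G
      & (s' *m rowsub (lift k0) f) 0 0 <= (s *m f) 0 0].
Proof.
move=> mN Gy s_ge0.
(* [t] is a dependence between the rows of [G], so [s + r *: t] keeps the
   constraints; [r] is the first value at which a weight vanishes. *)
have [t [t_neq0 tG tf]] : exists t : 'rV[R]_N.+1,
    [/\ t != 0, t *m G = 0 & (t *m f) 0 0 <= 0].
  have kG : kermx G != 0.
    by rewrite -mxrank_eq0 mxrank_ker subn_eq0 -ltnNge (leq_ltn_trans (rank_leq_col G)).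
  have /rowV0Pn[v /sub_kermxP vG v_neq0] := kG.
  have [vf|vf] := lerP ((v *m f) 0 0) 0; first by exists v.
  exists (- v); split; first by rewrite oppr_eq0.
    by rewrite mulNmx vG oppr0.
  by rewrite mulNmx mxE oppr_le0 ltW.
have t_sum0 : \sum_k t 0 k = 0.
  have := congr1 (fun M : 'rV[R]_m => (M *m y) 0 0) tG.
  rewrite -mulmxA Gy mul0mx !mxE => tGy; rewrite -[RHS]tGy.
  by apply: eq_bigr => k _; rewrite mxE mulr1.
have [k1 tk1] : exists k1, t 0 k1 < 0.
  apply/existsP; apply: contraNT t_neq0; rewrite negb_exists => /forallP t_ge0.
  have t0 k : 0 <= t 0 k by rewrite leNgt.
  apply/eqP/rowP => k; rewrite mxE.
  exact: (psumr_eq0P (fun k _ => t0 k) t_sum0).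
pose r k := s 0 k / - t 0 k.
case: (@Order.TotalTheory.arg_minP _ _ _ k1 (fun k => t 0 k < 0) r tk1) => k0 tk0 r_min.
have r_ge0 : 0 <= r k0 by rewrite divr_ge0// oppr_ge0 ltW.
pose s1 := s + r k0 *: t.
have s1_ge0 k : 0 <= s1 0 k.
  rewrite !mxE; have [tk|tk] := ltrP (t 0 k) 0; last by rewrite addr_ge0// mulr_ge0.
  have := r_min _ tk; rewrite {2}/r ler_pdivlMr ?oppr_gt0// mulrN.
  by rewrite lerNl -subr_ge0 opprK addrC.
have s1k0 : s1 0 k0 = 0.
  by rewrite !mxE /r invrN mulrN mulNr mulfVK ?lt_eqF// subrr.
(* As [s1] vanishes at [k0], deleting that index changes neither the constraints nor the
   objective. *)
have drop p (M : 'M[R]_(N.+1, p)) : colsub (lift k0) s1 *m rowsub (lift k0) M = s1 *m M.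
  apply/matrixP => i j; rewrite ord1 !mxE (bigD1_ord k0)//= s1k0 mul0r add0r.
  by apply: eq_bigr => k _; rewrite !mxE.
exists k0, (colsub (lift k0) s1); split.
- by move=> k; have := s1_ge0 (lift k0 k); rewrite !mxE.
- by rewrite drop mulmxDl -scalemxAl tG scaler0 addr0.
- by rewrite drop mulmxDl -scalemxAl mxE gerDl mxE mulr_ge0_le0.
Qed.

(** The surplus [d] counts the atoms to be dropped, one per induction step. The same [y] serves
    throughout, because every row selection of [G] still sends it to the constant 1; [h] records
    which atoms survive. *)
Lemma conic_caratheodory (R : realFieldType) (m d : nat) (G : 'M[R]_(d + m, m))
    (f : 'cV[R]_(d + m)) (y : 'cV[R]_m) (s : 'rV[R]_(d + m)) :
  G *m y = const_mx 1 -> (forall k, 0 <= s 0 k) ->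
  exists (h : 'I_m -> 'I_(d + m)) (s' : 'rV[R]_m),
    [/\ forall k, 0 <= s' 0 k, s' *m rowsub h G = s *m G
      & (s' *m rowsub h f) 0 0 <= (s *m f) 0 0].
Proof.
elim: d G f s => [|d IHd] G f s Gy s_ge0.
  exists id, s; split => //.
    by rewrite mxsub_id.
  by rewrite mxsub_id.
have [k0 [s1 [s1_ge0 s1G s1f]]] := conic_drop_atom f (leq_addl d m) Gy s_ge0.
have G1y : rowsub (lift k0) G *m y = const_mx 1.
  by rewrite mul_rowsub_mx [G *m y]Gy; apply/matrixP => i j; rewrite !mxE.
have [h [s2 [s2_ge0 s2G s2f]]] := IHd _ (rowsub (lift k0) f) _ G1y s1_ge0.
exists (lift k0 \o h), s2; split => //.
  by rewrite rowsub_comp s2G.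
by rewrite rowsub_comp (le_trans s2f).
Qed.

(** * Discretization of a finite measure *)

Lemma integral_bounded_fin_num d (T : measurableType d) (R : realType)
    (mu : {finite_measure set T -> \bar R}) (h : T -> R) (C : R) :
  measurable_fun setT h -> (forall t, 0 <= h t <= C) ->
  (\int[mu]_t (h t)%:E \is a fin_num)%E.
Proof.
move=> mh hC; rewrite ge0_fin_numE; last first.
  by apply: integral_ge0 => t _; rewrite lee_fin; case/andP: (hC t).
apply: (@le_lt_trans _ _ (\int[mu]_t (cst C%:E t))%E).
  apply: ge0_le_integral => //.
  - by move=> t _; rewrite lee_fin; case/andP: (hC t).
  - exact/measurable_EFinP.
  - by move=> t _; rewrite lee_fin; case/andP: (hC t).
by rewrite integral_cst// ltey_eq fin_numM// fin_num_measure.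
Qed.

(** All [h i] are rounded at once to a grid of mesh [dl]. One point per cell of common rounding,
    weighted by the measure of the cell, moves each integral by at most [dl] times the total
    mass. *)
Lemma finite_measure_discretization d (T : measurableType d) (R : realType)
    (mu : {finite_measure set T -> \bar R}) (I : finType) (h : I -> T -> R)
    (a : I -> R) (C eps : R) :
  0 < eps -> (forall i, measurable_fun setT (h i)) ->
  (forall i t, 0 <= h i t <= C) ->
  (forall i, \int[mu]_t (h i t)%:E = (a i)%:E)%E ->
  exists N (pt : 'I_N -> T) (s : 'I_N -> R),
    (forall k, 0 <= s k) /\ forall i, `|\sum_k s k * h i (pt k) - a i| <= eps.
Proof.
move=> eps_gt0 mh hC ha.
pose V := fine (mu setT).
have V_ge0 : 0 <= V by rewrite fine_ge0.
have muT : mu setT = V%:E by rewrite fineK// fin_num_measure.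
(* The added 1 keeps the denominator positive for the zero measure, and still [dl * V <= eps]. *)
pose dl := eps / (V + 1).
have V1 : 0 < V + 1 by rewrite ltr_wpDl.
have dl_gt0 : 0 < dl by rewrite divr_gt0.
(* As [h i <= C], no level index exceeds [M], so the [inord] in [code] loses nothing. *)
pose M := Num.truncn (C / dl).
pose P : finType := {ffun I -> 'I_M.+1}.
pose cell (p : P) : set T := \bigcap_(i in [set: I])
   h i @^-1` [set` `[(p i)%:R * dl, (p i).+1%:R * dl[%R].
have mcell p : measurable (cell p).
  apply: fin_bigcap_measurable => // i _.
  by rewrite -[X in measurable X]setTI; apply: mh.
pose code t : P := [ffun i => inord (Num.truncn (h i t / dl))].
have cellP p t : cell p t <-> p = code t.
  have codeE i : code t i = Num.truncn (h i t / dl) :> nat.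
    have /andP[h0 h1] := hC i t.
    by rewrite ffunE inordK// ltnS le_truncn// ler_wpM2r// invr_ge0 ltW.
  split=> [h1|->].
    apply/ffunP => i; apply/val_inj; rewrite [RHS]codeE; apply/esym/eqP.
    have := h1 i Logic.I; rewrite /= in_itv/= => /andP[h2 h3].
    by apply/eqP/truncn_def; rewrite ler_pdivlMr// ltr_pdivrMr// h2 h3.
  move=> i _ /=; rewrite in_itv/= codeE -ler_pdivlMr// -ltr_pdivrMr//.
  by rewrite truncn_itv// divr_ge0 ?(ltW dl_gt0)//; case/andP: (hC i t).
(* An empty cell receives the default point, with weight 0. *)
pose pt p := xget point (cell p).
pose s p := fine (mu (cell p)).
have sE p : (s p)%:E = mu (cell p) by rewrite fineK// fin_num_measure.
have near_pt i t : `|h i t - h i (pt (code t))| <= dl.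
  have tc : cell (code t) t by apply/cellP.
  have pc : cell (code t) (pt (code t)) by apply: xgetPex; exists t.
  have := tc i Logic.I; have := pc i Logic.I.
  rewrite /= !in_itv/= -natr1 mulrDl mul1r => /andP[p1 p2] /andP[t1 t2].
  by rewrite ler_norml; apply/andP; split; lra.
(* The simple function that takes on each cell the value of [h i] at the chosen point; its integral
   is the discrete sum. *)
pose hh i t := \sum_(p : P) h i (pt p) * \1_(cell p) t.
have hhE i t : hh i t = h i (pt (code t)).
  rewrite /hh (bigD1 (code t))//= indicE mem_set ?mulr1; last exact/cellP.
  rewrite big1 ?addr0// => p pt_neq; rewrite indicE memNset ?mulr0// => /cellP.
  by apply/eqP.
have mhh i : measurable_fun setT (hh i).
  rewrite /hh; apply: measurable_sum => p.
  by apply: measurable_funM.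
have int_hh i : (\int[mu]_t (hh i t)%:E = (\sum_p s p * h i (pt p))%:E)%E.
  under eq_integral do rewrite /hh -sumEFin.
  rewrite ge0_integral_sum//=; last 2 first.
    - by move=> p; apply/measurable_EFinP; exact: measurable_funM.
    - by move=> p t _; rewrite lee_fin mulr_ge0//; case/andP: (hC i (pt p)).
  rewrite -sumEFin; apply: eq_bigr => p _.
  under eq_integral do rewrite EFinM.
  rewrite ge0_integralZl_EFin//; last 2 first.
    - by apply/measurable_EFinP; exact: measurable_indic.
    - by case/andP: (hC i (pt p)).
  by rewrite integral_indic// setIT EFinM sE muleC.
have le_int (f g : T -> R) x y : measurable_fun setT f -> measurable_fun setT g ->
    (forall t, 0 <= f t) -> (forall t, 0 <= g t) -> (forall t, f t <= g t + dl) ->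
    (\int[mu]_t (f t)%:E = x%:E)%E -> (\int[mu]_t (g t)%:E = y%:E)%E ->
    x <= y + dl * V.
  move=> mf mg f0 g0 fg fx gy.
  rewrite -lee_fin EFinD EFinM -fx -gy -muT -integral_cst//.
  rewrite -ge0_integralD//; last 3 first.
    - by move=> t _; rewrite lee_fin.
    - exact/measurable_EFinP.
    - by move=> t _; rewrite lee_fin ltW.
  apply: ge0_le_integral => //.
  - by move=> t _; rewrite lee_fin.
  - exact/measurable_EFinP.
  - by apply: emeasurable_funD => //; exact/measurable_EFinP.
  - by move=> t _; rewrite -EFinD lee_fin.
exists #|P|, (pt \o @enum_val P P), (s \o @enum_val P P); split=> [k|i].
  by rewrite fine_ge0.
have -> : \sum_k (s \o @enum_val P P) k * h i ((pt \o @enum_val P P) k) =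
          \sum_p s p * h i (pt p).
  by symmetry; apply: reindex; apply: onW_bij; exact: enum_val_bij.
have dlV : dl * V <= eps.
  by rewrite /dl mulrAC ler_pdivrMr// ler_wpM2l ?(ltW eps_gt0)// lerDl.
have hh_ge0 t : 0 <= hh i t by rewrite hhE; case/andP: (hC i (pt (code t))).
have h_ge0 t : 0 <= h i t by case/andP: (hC i t).
have near1 t : h i t <= hh i t + dl.
  by have := near_pt i t; rewrite hhE ler_norml => /andP[]; lra.
have near2 t : hh i t <= h i t + dl.
  by have := near_pt i t; rewrite hhE ler_norml => /andP[]; lra.
have H1 := le_int _ _ _ _ (mh i) (mhh i) h_ge0 hh_ge0 near1 (ha i) (int_hh i).
have H2 := le_int _ _ _ _ (mhh i) (mh i) hh_ge0 h_ge0 near2 (int_hh i) (ha i).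
by rewrite ler_norml; apply/andP; split; lra.
Qed.

(** * Homogeneity, bounds and continuity of the integrands *)

Section maxover_ell.
Context (R : realType) (n : nat).
Implicit Types (v : 'I_n.+1 -> R) (J : {set 'I_n.+1}) (w : 'I_n.+1 -> R).

Lemma maxover_ge0 J v : 0 <= maxover J v.
Proof. exact: bigmax_ge_id. Qed.

Lemma maxover_le1 J v : (forall j, v j <= 1) -> maxover J v <= 1.
Proof. by move=> v1; apply: bigmax_le. Qed.

Lemma maxover_set1 j v : 0 <= v j -> maxover [set j]%SET v = v j.
Proof. by move=> vj; rewrite /maxover big_set1E max_l. Qed.

Lemma maxover_homog J a v : 0 <= a -> maxover J (fun j => a * v j) = a * maxover J v.
Proof.
move=> a_ge0; apply/esym; rewrite /maxover.
apply: (big_morph (fun x => a * x)) => [x y|]; last exact: mulr0.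
exact: maxr_pMr.
Qed.

Lemma ell_ge0 xi w v : 0 <= ell xi w v.
Proof. exact: powR_ge0. Qed.

Lemma ell_homog xi w a v : 0 < xi -> (forall j, 0 <= w j) -> (forall j, 0 <= v j) ->
  0 <= a -> ell xi w (fun j => a * v j) = a * ell xi w v.
Proof.
move=> xi_gt0 w_ge0 v_ge0 a_ge0; rewrite /ell.
have -> : \sum_j w j * (a * v j) `^ xi = a `^ xi * \sum_j w j * v j `^ xi.
  by rewrite mulr_sumr; apply: eq_bigr => j _; rewrite powRM// mulrCA.
rewrite powRM ?powR_ge0 ?sumr_ge0//; last by move=> j _; rewrite mulr_ge0// powR_ge0.
by rewrite -powRrM div1r mulfV ?gt_eqF// powRr1.
Qed.

(** Supplies the uniform bound on the simplex required by the discretization and by the finiteness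
    of the objective. *)
Lemma ell_le xi w v : 0 < xi -> (forall j, 0 <= w j) -> (forall j, 0 <= v j <= 1) ->
  ell xi w v <= (\sum_j w j) `^ (1 / xi).
Proof.
move=> xi_gt0 w_ge0 v01; apply: ge0_ler_powR; rewrite ?nnegrE.
- by rewrite divr_ge0// ltW.
- by apply: sumr_ge0 => j _; rewrite mulr_ge0// powR_ge0.
- exact: sumr_ge0.
apply: ler_sum => j _; rewrite ler_piMr//.
have /andP[v0 v1] := v01 j.
have := @ge0_ler_powR R xi (ltW xi_gt0) (v j) 1.
by rewrite powR1 !nnegrE; apply.
Qed.

End maxover_ell.

(* The absolute value is needed: [x `^ p] is 1 for [x < 0]. *)
Lemma norm_powR_continuous (R : realType) (p : R) :
  0 < p -> continuous (fun x : R => `|x| `^ p).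
Proof.
move=> p_gt0 x; have [->|x_neq0] := eqVneq x 0.
  apply/cvgrPdist_lt => e e_gt0.
  rewrite normr0 powR0 ?gt_eqF//; near=> y.
  rewrite sub0r normrN ger0_norm ?powR_ge0//.
  (* By monotonicity of the power, it is enough that [|y|] be below the [p]-th root of [e]. *)
  have -> : e = (e `^ p^-1) `^ p by rewrite -powRrM mulVf ?gt_eqF// powRr1 ?ltW.
  rewrite gt0_ltr_powR ?nnegrE ?powR_ge0//.
  near: y; apply: cvgr0_norm_lt; last exact: powR_gt0.
  exact: cvg_id.
(* Away from 0 the absolute value is positive, where the power is differentiable. *)
apply: (@continuous_comp _ _ _ (fun x : R => `|x|) (fun x => x `^ p)).
  exact: norm_continuous.
apply/differentiable_continuous/derivable1_diffP.
by apply: derivable_powR; rewrite in_itv/= andbT normr_gt0.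
Unshelve. all: by end_near. Qed.

Section continuity.
Context (R : realType) (n : nat) (T : topologicalType).
Variables (v : T -> 'I_n.+1 -> R) (x : T).
Hypothesis v_cont : forall j, {for x, continuous (fun t => v t j)}.

Lemma maxover_continuous J : maxover J (v t) @[t --> x] --> maxover J (v x).
Proof.
rewrite /maxover; elim: (index_enum _) => [|j s IHs].
  by under eq_fun do rewrite big_nil; rewrite big_nil; exact: cvg_cst.
under eq_fun do rewrite big_cons; rewrite big_cons.
case: (j \in J) => //.
exact: (@continuous_max _ _ (fun t => v t j) _ _ (@v_cont j) IHs).
Qed.

(** Non-negativity at every [t] lets absolute values be inserted under both powers, so that each
    becomes a globally continuous function. *)
Lemma ell_continuous xi w : 0 < xi -> (forall j, 0 <= w j) -> (forall t j, 0 <= v t j) ->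
  ell xi w (v t) @[t --> x] --> ell xi w (v x).
Proof.
move=> xi_gt0 w_ge0 v_ge0.
pose g t := \sum_j w j * `|v t j| `^ xi.
have ellE t : ell xi w (v t) = `|g t| `^ (1 / xi).
  rewrite /ell ger0_norm; last first.
    by apply: sumr_ge0 => j _; rewrite mulr_ge0// powR_ge0.
  by congr (_ `^ _); apply: eq_bigr => j _; rewrite ger0_norm.
rewrite ellE; under eq_fun do rewrite ellE.
apply: (@continuous_comp _ _ _ g (fun y => `|y| `^ (1 / xi))); last first.
  by apply: norm_powR_continuous; rewrite divr_gt0.
apply: cvg_big => [y|j _]; first exact: add_continuous.
 apply: cvgM; first exact: cvg_cst.
apply: (@continuous_comp _ _ _ (fun t => v t j) (fun y => `|y| `^ xi)); first exact: (@v_cont j).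
exact: norm_powR_continuous.
Qed.

End continuity.

(** * Measurability of the integrands on the simplex *)

Section simplex_measurability.
Context (R : realType) (n : nat).
Implicit Type u : simplexB R n.

Lemma coords_ge0 u j : 0 <= coords u j.
Proof. by have [+ _] := set_valP (u : simplexT R n); exact. Qed.

Lemma coords_sum u : \sum_j coords u j = 1.
Proof. by have [_ +] := set_valP (u : simplexT R n). Qed.

Lemma coords_le1 u j : coords u j <= 1.
Proof.
rewrite -(coords_sum u) (bigD1 j)//= lerDl.
by apply: sumr_ge0 => i _; exact: coords_ge0.
Qed.

(** Open intervals generate the Borel sets of the line, and their preimages are open because
    coordinates are continuous for the subspace topology. *)
Lemma measurable_coords j : measurable_fun setT (fun u => coords u j).
Proof.
apply: (measurability _ (RGenOpens.measurableE R)) => _ [_ [a [b ->]] <-].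
rewrite setTI; apply: sub_sigma_algebra.
apply: (@open_comp (simplexT R n) R); last exact: interval_open.
move=> u _; apply: (@continuous_comp (simplexT R n) _ _ set_val (fun M : 'rV[R]_n.+1 => M ord0 j)).
  exact: initial_continuous.
exact: coord_continuous.
Qed.

Lemma measurable_maxover_coords J : measurable_fun setT (fun u => maxover J (coords u)).
Proof.
rewrite /maxover; elim: (index_enum _) => [|j s IHs].
  by under eq_fun do rewrite big_nil; exact: measurable_cst.
under eq_fun do rewrite big_cons.
by case: (j \in J) => //; apply: measurable_maxr => //; exact: measurable_coords.
Qed.

Lemma measurable_ell_coords xi w : measurable_fun setT (fun u => ell xi w (coords u)).
Proof.
apply: (measurableT_comp (measurable_powR _)).
apply: measurable_sum => j; apply: measurable_funM => //.
by apply: (measurableT_comp (measurable_powR _)); exact: measurable_coords.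
Qed.

End simplex_measurability.

(** * From matrices to discrete measures *)

Section atomic_measure.
Context d (T : measurableType d) (R : realType).
Variables (m : nat) (s : nat -> {nonneg R}) (u : nat -> T).

Definition atomic_measure := msum (fun k => mscale (s k) \d_(u k)) m.

HB.instance Definition _ := Measure.on atomic_measure.

Let atomic_measure_fin : fin_num_fun atomic_measure.
Proof.
move=> U mU; rewrite /atomic_measure /msum; apply/sum_fin_numP => i _ _.
by rewrite /= /mscale fin_numM// diracE.
Qed.

HB.instance Definition _ := @Measure_isFinite.Build _ _ _ atomic_measure atomic_measure_fin.

Lemma integral_atomic_measure (g : T -> R) :
  measurable_fun setT g -> (forall t, 0 <= g t) ->
  (\int[atomic_measure]_t (g t)%:E = (\sum_(k < m) (s k)%:num * g (u k))%:E)%E.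
Proof.
move=> mg g_ge0; have mEg : measurable_fun setT (EFin \o g) by exact/measurable_EFinP.
rewrite ge0_integral_measure_sum//; last by move=> t _; rewrite lee_fin.
rewrite -sumEFin; apply: eq_bigr => k _.
rewrite ge0_integral_mscale//; last by move=> t _; rewrite lee_fin.
by rewrite integral_dirac// diracT mul1e EFinM.
Qed.

End atomic_measure.

(** The radial part is the sum of the coordinates; the zero vector has no direction and gets weight
    0 at an arbitrary point. *)
Lemma polar_decomposition (R : realType) (n : nat) (v : 'I_n.+1 -> R) :
  (forall j, 0 <= v j) ->
  exists (a : {nonneg R}) (u : simplexB R n), forall j, v j = a%:num * coords u j.
Proof.
move=> v_ge0; have a_ge0 : 0 <= \sum_j v j by exact: sumr_ge0.
have [a0|a_neq0] := eqVneq (\sum_j v j) 0.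
  exists 0%:nng, point => j; rewrite mul0r.
  by apply: (psumr_eq0P (fun i _ => v_ge0 i) a0).
have uP : (\row_j (v j / \sum_i v i) : 'rV[R]_n.+1) \in @simplex R n.
  rewrite inE; split=> [j|]; first by rewrite mxE divr_ge0.
  under eq_bigr do rewrite mxE.
  by rewrite -mulr_suml divff.
exists (NngNum a_ge0), (SigSub uP : simplexT R n) => j.
by rewrite /coords /= mxE mulrC divfK.
Qed.

Section reduction.
Context (R : realType) (n : nat) (xi : R) (w : 'I_n.+1 -> R).
Context (calJ : {set {set 'I_n.+1}}) (c : {set 'I_n.+1} -> R).
Hypothesis xi_gt0 : 0 < xi.
Hypothesis w_ge0 : forall j, 0 <= w j.

Lemma coefmat_measure (A : 'M[R]_(n.+1, #|calJ|)) : coefmat calJ c A ->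
  exists2 H : {finite_measure set (simplexB R n) -> \bar R},
    feasible calJ c H & objective xi w H = (coefmat_obj xi w A)%:E.
Proof.
move=> [A_ge0 AJ].
have [s sP] := choice (fun K => polar_decomposition (A_ge0^~ K)).
have [u suP] := choice sP.
(* Atoms are indexed by [nat]; the defaults from [#|calJ|] on never enter the sum. *)
pose s' k : {nonneg R} := if insub k is Some K then s K else NngNum (lexx 0).
pose u' k := if insub k is Some K then u K else point.
pose H : {finite_measure set (simplexB R n) -> \bar R} := atomic_measure #|calJ| s' u'.
(* Homogeneity absorbs the weight of an atom into its column; this serves the constraints and the
   objective alike. *)
have intH (g : ('I_n.+1 -> R) -> R) :
    measurable_fun setT (fun u : simplexB R n => g (coords u)) ->
    (forall v, 0 <= g v) ->
    (forall a v, 0 <= a -> (forall j, 0 <= v j) -> g (fun j => a * v j) = a * g v) ->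
    (\int[H]_u (g (coords u))%:E = (\sum_K g (fun j => A j K))%:E)%E.
  move=> mg g_ge0 g_homog; rewrite integral_atomic_measure//.
  congr (_%:E); apply: eq_bigr => K _; rewrite /s' /u' valK.
  rewrite -g_homog//; last by move=> j; exact: coords_ge0.
  by congr g; apply/funext => j; rewrite suP.
exists H.
  move=> J JJ; rewrite (intH (maxover J)) ?AJ//.
  - exact: measurable_maxover_coords.
  - by move=> v; exact: maxover_ge0.
  - by move=> a v a_ge0 _; exact: maxover_homog.
rewrite /objective (intH (ell xi w))//.
- exact: measurable_ell_coords.
- by move=> v; exact: ell_ge0.
- by move=> a v a_ge0 v_ge0; exact: ell_homog.
Qed.

(** * From feasible measures to approximately admissible matrices *)

Hypothesis calJ_set1 : forall j, [set j]%SET \in calJ.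

(** Only the discretization costs an error: the reduction to [#|calJ|] atoms keeps the perturbed
    constraint values exactly and does not raise [sg] times the objective. *)
Lemma approx_coefmat (H : {finite_measure set (simplexB R n) -> \bar R}) (sg e : R) :
  feasible calJ c H -> 0 < e ->
  exists A : 'M[R]_(n.+1, #|calJ|),
  [/\ forall j K, 0 <= A j K,
      forall J, J \in calJ -> `|\sum_K maxover J (fun j => A j K) - c J| <= e &
      sg * coefmat_obj xi w A <= sg * fine (objective xi w H) + `|sg| * e].
Proof.
move=> Hc e_gt0.
(* [None] stands for the objective, so that a single discretization serves it together with all
   constraints. *)
pose g (i : option {set 'I_n.+1}) (u : simplexB R n) :=
  if i is Some J then maxover J (coords u) else ell xi w (coords u).
pose W := (\sum_j w j) `^ (1 / xi).
have W_ge0 : 0 <= W by exact: powR_ge0.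
have mg i : measurable_fun setT (g i).
  by case: i => [J|]; [exact: measurable_maxover_coords|exact: measurable_ell_coords].
have g_bnd i u : 0 <= g i u <= 1 + W.
  case: i => [J|]; rewrite /g ?maxover_ge0 ?ell_ge0 /=.
    by rewrite (@le_trans _ _ 1) ?lerDl// maxover_le1// => j; exact: coords_le1.
  rewrite (@le_trans _ _ W) ?lerDr// ell_le// => j.
  by rewrite coords_ge0 coords_le1.
have gE i : (\int[H]_u (g i u)%:E = (fine (\int[H]_u (g i u)%:E))%:E)%E.
  by rewrite fineK// (integral_bounded_fin_num _ (mg i) (g_bnd i)).
have [N [pt [s [s_ge0 gP]]]] := finite_measure_discretization e_gt0 mg g_bnd gE.
(* [#|calJ|] atoms of weight 0 are added so that [conic_caratheodory] applies
   even when [N < #|calJ|]. *)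
pose pt' (k : 'I_(N + #|calJ|)) := if fintype.split k is inl i then pt i else point.
pose s' : 'rV[R]_(N + #|calJ|) := row_mx (\row_i s i) 0.
pose G := \matrix_(k < N + #|calJ|, l < #|calJ|) maxover (enum_val l) (coords (pt' k)).
pose f := \col_(k < N + #|calJ|) (sg * ell xi w (coords (pt' k))).
(* The indicator of the singletons in [calJ]: it adds up the coordinates of each atom, which gives
   1. *)
pose y : 'cV[R]_#|calJ| := \col_l \sum_j ([set j]%SET == enum_val l)%:R.
have Gy : G *m y = const_mx 1.
  apply/matrixP => k k'; rewrite !mxE -(coords_sum (pt' k)).
  under eq_bigr do rewrite !mxE mulr_sumr.
  rewrite exchange_big/=; apply: eq_bigr => j _.
  rewrite (bigD1 (enum_rank_in (calJ_set1 j) [set j]%SET))//= enum_rankK_in// eqxx mulr1.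
  rewrite maxover_set1 ?coords_ge0// big1 ?addr0// => l lj.
  case: eqP => [jl|_]; last by rewrite mulr0.
  by case/eqP: lj; rewrite -[LHS](enum_valK_in (calJ_set1 j)) -jl.
have s'_ge0 k : 0 <= s' 0 k.
  by rewrite mxE; case: fintype.split => i; rewrite mxE.
have s'E (F : simplexB R n -> R) : \sum_k s' 0 k * F (pt' k) = \sum_k s k * F (pt k).
  rewrite big_split_ord/= [X in _ + X]big1 ?addr0 => [|i _]; last first.
    by rewrite row_mxEr mxE mul0r.
  apply: eq_bigr => i _; rewrite row_mxEl mxE /pt'.
  by rewrite (unsplitK (inl i)).
have [h [t [t_ge0 tG tf]]] := conic_caratheodory f Gy s'_ge0.
exists (\matrix_(j, K) (t 0 K * coords (pt' (h K)) j)); split.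
- by move=> j K; rewrite mxE mulr_ge0// coords_ge0.
- move=> J JJ.
  have GE k : G k (enum_rank_in JJ J) = g (Some J) (pt' k).
    by rewrite mxE enum_rankK_in.
  have tJ : \sum_K t 0 K * g (Some J) (pt' (h K)) = \sum_k s k * g (Some J) (pt k).
    have := congr1 (fun M : 'rV_#|calJ| => M 0 (enum_rank_in JJ J)) tG.
    rewrite -(s'E (g (Some J))) mxE [RHS]mxE.
    under eq_bigr do rewrite [X in _ * X]mxE GE.
    by under [RHS]eq_bigr do rewrite GE.
  have -> : \sum_K maxover J (fun j => (\matrix_(j, K) (t 0 K * coords (pt' (h K)) j)) j K) =
      \sum_k s k * g (Some J) (pt k).
    rewrite -tJ; apply: eq_bigr => K _.
    by rewrite -maxover_homog//; congr maxover; apply/funext => j; rewrite mxE.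
  by have := gP (Some J); rewrite [X in fine X](Hc _ JJ).
- have objE : coefmat_obj xi w (\matrix_(j, K) (t 0 K * coords (pt' (h K)) j)) =
      \sum_K t 0 K * ell xi w (coords (pt' (h K))).
    rewrite /coefmat_obj; apply: eq_bigr => K _.
    rewrite -(ell_homog xi_gt0 w_ge0 (coords_ge0 (pt' (h K))) (t_ge0 K)).
    by congr (ell xi w _); apply/funext => j; rewrite mxE.
  have fE k : f k 0 = sg * g None (pt' k) by rewrite mxE.
  move: tf; rewrite mxE [leRHS]mxE.
  under eq_bigr do rewrite [X in _ * X]mxE fE mulrCA.
  rewrite -mulr_sumr -objE => /le_trans; apply.
  under eq_bigr do rewrite fE mulrCA.
  rewrite -mulr_sumr (s'E (g None)).
  rewrite -lerBlDl -mulrBr (le_trans (ler_norm _))// normrM ler_wpM2l//.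
  exact: (gP None).
Qed.

(** * Passing to the limit by compactness *)

(** A non-negative penalty, zero exactly when [A] meets the constraints and
    [sg * coefmat_obj xi w A <= sg * o]. *)
Definition coefmat_gap (sg o : R) (A : 'M[R]_(n.+1, #|calJ|)) : R :=
  \sum_(J in calJ) `|\sum_K maxover J (fun j => A j K) - c J| +
  Num.max 0 (sg * coefmat_obj xi w A - sg * o).

Lemma coefmat_gap_continuous (sg o : R) (T : topologicalType)
    (A : T -> 'M[R]_(n.+1, #|calJ|)) (x : T) :
  (forall t j K, 0 <= A t j K) ->
  (forall j K, {for x, continuous (fun t => A t j K)}) ->
  {for x, continuous (fun t => coefmat_gap sg o (A t))}.
Proof.
move=> A_ge0 A_cont; apply: cvgD.
  apply: cvg_big => [y|J _]; first exact: add_continuous.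
  apply: cvg_norm; apply: cvgB; last exact: cvg_cst.
  apply: cvg_big => [y|K _]; first exact: add_continuous.
  exact: (maxover_continuous (A_cont^~ K)).
apply: (@continuous_max _ _ (cst 0) (fun t => sg * coefmat_obj xi w (A t) - sg * o)).
  exact: cvg_cst.
apply: cvgB; last exact: cvg_cst.
apply: cvgM; first exact: cvg_cst.
apply: cvg_big => [y|K _]; first exact: add_continuous.
by apply: (ell_continuous (A_cont^~ K)).
Qed.

Lemma coefmat_compactness (B sg o D : R) : 0 <= D ->
  (forall e, 0 < e <= 1 -> exists A : 'M[R]_(n.+1, #|calJ|),
    (forall j K, 0 <= A j K <= B) /\ coefmat_gap sg o A <= D * e) ->
  exists2 A, coefmat calJ c A & sg * coefmat_obj xi w A <= sg * o.
Proof.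
move=> D_ge0 happrox.
(* Matrices are viewed as functions on index pairs, so that Tychonoff's theorem makes the box
   compact. *)
pose X : topologicalType := prod_topology (fun _ : 'I_n.+1 * 'I_#|calJ| => R).
(* Absolute values make the entries non-negative off the box too, so that the
   gap is continuous on the whole of [X]. *)
pose mat (f : X) : 'M[R]_(n.+1, #|calJ|) := \matrix_(j, K) `|f (j, K)|.
have mat_ge0 f j K : 0 <= mat f j K by rewrite mxE.
have mat_cont (f : X) j K : {for f, continuous (fun g : X => mat g j K)}.
  have matE (g : X) : mat g j K = `|g (j, K)| by rewrite mxE.
  rewrite /prop_for /continuous_at matE; under eq_fun do rewrite matE.
  apply: (@continuous_comp _ _ _ (fun g : X => g (j, K)) (fun x : R => `|x|)).
    exact: (@proj_continuous _ (fun _ : 'I_n.+1 * 'I_#|calJ| => R) (j, K)).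
  exact: norm_continuous.
pose box : set X := [set f | forall p, `[0, B]%classic (f p)].
have box_compact : compact box.
  by apply: (@tychonoff _ (fun _ => R) (fun _ => `[0, B]%classic)) => p; exact: segment_compact.
have small e : 0 < e <= 1 ->
    exists2 f : X, box f & coefmat_gap sg o (mat f) <= D * e.
  move=> /happrox [A [A_box A_gap]].
  exists (fun p => A p.1 p.2).
    by move=> [j K] /=; rewrite in_itv/= A_box.
  have -> // : mat (fun p => A p.1 p.2) = A.
  by apply/matrixP => j K; rewrite mxE/= ger0_norm//; case/andP: (A_box j K).
have box_neq0 : box !=set0.
  by have [|f bf _] := small 1; [rewrite ltr01 lexx|exists f].
have [|f _ f_min] := compact_EVT_min (f := fun f => coefmat_gap sg o (mat f)) box_neq0 box_compact.
  by apply: continuous_subspaceT => f; apply: coefmat_gap_continuous.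
have f_le0 : coefmat_gap sg o (mat f) <= 0.
  apply/ler_addgt0Pr => e e_gt0; rewrite add0r.
  (* Approximations are available only up to error 1; the other term ensures [D * e' <= e], also for
     [D = 0]. *)
  pose e' := Num.min 1 (e / (D + 1)).
  have D1 : 0 < D + 1 by rewrite ltr_wpDl.
  have [|g bg g_le] := small e'.
    by rewrite lt_min ltr01 divr_gt0//= ge_min lexx.
  rewrite (le_trans (f_min g _)) ?inE// (le_trans g_le)//.
  rewrite (@le_trans _ _ (D * (e / (D + 1))))//.
    by rewrite ler_wpM2l// ge_min lexx orbT.
  by rewrite mulrCA ler_piMr ?(ltW e_gt0)// ler_pdivrMr// mul1r lerDl.
have max_ge0 (x : R) : 0 <= Num.max 0 x by rewrite le_max lexx.
have sum_ge0 : 0 <= \sum_(J in calJ) `|\sum_K maxover J (fun j => mat f j K) - c J|.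
  exact: sumr_ge0.
have [sum_eq0 max_eq0] : \sum_(J in calJ) `|\sum_K maxover J (fun j => mat f j K) - c J| = 0
    /\ Num.max 0 (sg * coefmat_obj xi w (mat f) - sg * o) = 0.
  move: f_le0; rewrite /coefmat_gap => f_le0.
  have := max_ge0 (sg * coefmat_obj xi w (mat f) - sg * o).
  by split; lra.
exists (mat f).
  split=> // J JJ; apply/eqP; rewrite -subr_eq0 -normr_eq0.
  by rewrite (psumr_eq0P _ sum_eq0).
by rewrite -subr_le0 -[leRHS]max_eq0 le_max lexx orbT.
Qed.

Hypothesis c_set1 : forall j, c [set j]%SET = 1.

Lemma feasible_coefmat (H : {finite_measure set (simplexB R n) -> \bar R}) (sg : R) :
  feasible calJ c H ->
  exists2 A, coefmat calJ c A &
    sg * coefmat_obj xi w A <= sg * fine (objective xi w H).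
Proof.
(* The singleton constraints bound each row sum by [1 + e], hence each entry by 2. Each set of
   [calJ] adds at most [e] to the gap, and the objective at most [|sg| * e]. *)
move=> Hc; apply: (@coefmat_compactness 2 _ _ (#|calJ|%:R + `|sg|)) => [|e /andP[e_gt0 e_le1]].
  by rewrite addr_ge0.
have [A [A_ge0 A_gap A_obj]] := approx_coefmat sg Hc e_gt0.
exists A; split=> [j K|].
  rewrite A_ge0/=.
  have := A_gap _ (calJ_set1 j); rewrite c_set1 ler_norml => /andP[_].
  rewrite (bigD1 K)//= maxover_set1//.
  have : 0 <= \sum_(i < #|calJ| | i != K) maxover [set j]%SET (fun j => A j i).
    by apply: sumr_ge0 => i _; exact: maxover_ge0.
  lra.
rewrite mulrDl lerD//.
  by rewrite mulr_natl -sumr_const; exact: ler_sum.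
by rewrite ge_max mulr_ge0 ?(ltW e_gt0)//= lerBlDl.
Qed.

End reduction.

(** * Equality of the optimal values *)

Theorem theorem3p2 (R : realType) (n : nat) (xi : R) (w : 'I_n.+1 -> R)
    (calJ : {set {set 'I_n.+1}}) (c : {set 'I_n.+1} -> R)
    (xi_gt0 : 0 < xi) (xi_le1 : xi <= 1)
    (w_gt0 : forall j, 0 < w j)
    (calJ_nonempty : forall J, J \in calJ -> J != finset.set0)
    (c_ge0 : forall J, J \in calJ -> 0 <= c J)
    (singletons : forall j : 'I_n.+1,
       [set j]%SET \in calJ /\ c [set j]%SET = 1)
    (sum_lt : forall u : simplexB R n,
       \sum_j coords u j < \sum_(J in calJ) maxover J (coords u))
    (feasible_nonempty :
       exists H : {finite_measure set (simplexB R n) -> \bar R},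
         feasible calJ c H) :
  lower_value calJ c xi w =
    ereal_inf [set (coefmat_obj xi w A)%:E | A in coefmat calJ c] /\
  upper_value calJ c xi w =
    ereal_sup [set (coefmat_obj xi w A)%:E | A in coefmat calJ c].
Proof.
have w_ge0 j : 0 <= w j by exact: ltW.
have calJ_set1 j : [set j]%SET \in calJ by have [] := singletons j.
have c_set1 j : c [set j]%SET = 1 by have [] := singletons j.
(* The integrand is bounded on the simplex, so objectives are finite and real inequalities transfer
   to the extended reals. *)
have obj_fin (H : {finite_measure set (simplexB R n) -> \bar R}) :
    objective xi w H = (fine (objective xi w H))%:E.
  rewrite fineK// (integral_bounded_fin_num _ (measurable_ell_coords _ _)
    (C := (\sum_j w j) `^ (1 / xi)))// => u.
  by rewrite ell_ge0 ell_le// => j; rewrite coords_ge0 coords_le1.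
split; apply/eqP; rewrite eq_le; apply/andP; split.
- apply: le_ereal_inf_tmp => _ [A Ac <-].
  have [H Hc <-] := coefmat_measure xi_gt0 w_ge0 Ac.
  by apply: ereal_inf_lbound; exists H.
- apply: le_ereal_inf_tmp => _ [H Hc <-].
  have [A Ac A_le] := feasible_coefmat xi_gt0 w_ge0 calJ_set1 c_set1 1 Hc.
  apply: (@le_trans _ _ (coefmat_obj xi w A)%:E).
    by apply: ereal_inf_lbound; exists A.
  by rewrite obj_fin lee_fin; move: A_le; rewrite !mul1r.
- apply: ge_ereal_sup => _ [H Hc <-].
  have [A Ac A_le] := feasible_coefmat xi_gt0 w_ge0 calJ_set1 c_set1 (-1) Hc.
  apply: (@le_trans _ _ (coefmat_obj xi w A)%:E).
    by rewrite obj_fin lee_fin; move: A_le; rewrite !mulN1r lerN2.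
  by apply: ereal_sup_ubound; exists A.
- apply: ge_ereal_sup => _ [A Ac <-].
  have [H Hc <-] := coefmat_measure xi_gt0 w_ge0 Ac.
  by apply: ereal_sup_ubound; exists H.
Qed.
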